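(* Let $X$ be a real Banach space and let $Y$ be a closed subspace of $X$ with the $1\frac12$-ball property. Then $Y$ has property-$(wU)$ in $X$ if and only if $Y$ has property-$(U)$ in $X$.
   Context: $B[x,r]$ denotes the closed ball with centre $x$ and radius $r$. $Y$ has the $1\frac12$-ball property in $X$ if for any $x\in X$, $y\in Y$, $r_1,r_2>0$ with $\|x-y\|<r_1+r_2$ and $B[x,r_2]\cap Y\neq\emptyset$, we have $B[y,r_1]\cap B[x,r_2]\cap Y\ne\emptyset$. $Y$ has property-$(U)$ in $X$ if every bounded linear functional on $Y$ has a unique norm-preserving extension to $X$. $Y$ has property-$(wU)$ in $X$ if every $y^*\in Y^*$ satisfying $\|y^*\|=|y^*(y_0)|$ for some $y_0\in S_Y$ (the unit sphere of $Y$) has a unique norm-preserving extension to $X$. *)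

(* Defs.v *)
From HB Require Import structures.
From mathcomp Require Import all_boot all_order all_algebra.
From mathcomp Require Import all_classical all_reals all_analysis.
Set Implicit Arguments.
Unset Strict Implicit.
Unset Printing Implicit Defensive.
Import Order.TTheory GRing.Theory Num.Theory.
Import numFieldNormedType.Exports.

Local Open Scope classical_set_scope.
Local Open Scope ring_scope.

(* A linear subspace [Y] of [X] as a normed space in its own right, with the
   norm of [X]. *)
Section subspace.
Context (R : realType) (X : normedModType R) (Y : submodClosed X).

Record subspace_of : Type := SubspaceOf {
  subspace_val : X ;
  subspace_valP : subspace_val \in Y }.

HB.instance Definition _ := [isSub for subspace_val].
HB.instance Definition _ := [Choice of subspace_of by <:].
HB.instance Definition _ := [SubChoice_isSubLmodule of subspace_of by <:].

Definition subspace_norm (y : subspace_of) : R := `|\val y|.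

Lemma subspace_ler_normD (x y : subspace_of) :
  subspace_norm (x + y) <= subspace_norm x + subspace_norm y.
Proof. by rewrite /subspace_norm raddfD ler_normD. Qed.

Lemma subspace_normrZ (a : R) (y : subspace_of) :
  subspace_norm (a *: y) = `|a| * subspace_norm y.
Proof. by rewrite /subspace_norm linearZ normrZ. Qed.

Lemma subspace_normr0_eq0 (y : subspace_of) : subspace_norm y = 0 -> y = 0.
Proof. by move=> /normr0_eq0 y0; apply: val_inj; rewrite y0 raddf0. Qed.

HB.instance Definition _ := Lmodule_isNormed.Build R subspace_of
  subspace_ler_normD subspace_normrZ subspace_normr0_eq0.

End subspace.

Section functionals.
Context (R : realType).

(* [sup] is the real supremum, so this is the dual norm of [f] only when
   [f] is bounded. *)
Definition dual_norm (V : normedModType R) (f : {linear V -> R^o}) : R :=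
  sup [set `|f x| | x in [set x : V | `|x| <= 1]].

Context (X : normedModType R) (Y : submodClosed X).

Definition norm_preserving_extension
    (f : {linear subspace_of Y -> R^o}) (g : {linear X -> R^o}) : Prop :=
  [/\ bounded_fun_norm g,
      forall y : subspace_of Y, g (\val y) = f y
    & dual_norm g = dual_norm f].

Definition one_half_ball_property : Prop :=
  forall (x y : X) (r1 r2 : R), y \in Y -> 0 < r1 -> 0 < r2 ->
    `|x - y| < r1 + r2 ->
    closed_ball_ Num.norm x r2 `&` [set` Y] !=set0 ->
    closed_ball_ Num.norm y r1 `&` closed_ball_ Num.norm x r2 `&` [set` Y] !=set0.

Definition property_U : Prop :=
  forall f : {linear subspace_of Y -> R^o}, bounded_fun_norm f ->
    exists! g : {linear X -> R^o}, norm_preserving_extension f g.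

Definition property_wU : Prop :=
  forall f : {linear subspace_of Y -> R^o}, bounded_fun_norm f ->
    (exists2 y0 : subspace_of Y, `|y0| = 1 & dual_norm f = `|f y0|) ->
    exists! g : {linear X -> R^o}, norm_preserving_extension f g.

End functionals.

(* Main.v *)
Require Import Defs.
From HB Require Import structures.
From mathcomp Require Import all_boot all_order all_algebra.
From mathcomp Require Import all_classical all_reals all_analysis.
From mathcomp Require Import lra.
Import Order.TTheory GRing.Theory Num.Theory.
Import numFieldNormedType.Exports.

Local Open Scope classical_set_scope.
Local Open Scope ring_scope.

(** Fix a functional [f] on [Y] with norm [N].  A norm-preserving extension of
    [f] is the same thing as a linear functional below the sublinear one
      [p_f x = inf_(y in Y) (N * `|x - y| + f y)]
    ([extension_le_upper], [extension_of_le_upper]).  By Hahn-Banach the value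
    [p_f x] is attained at [x] by some extension, and the least possible value
    there is [- p_f (- x)]; so the extension is unique if and only if
    [p_f x + p_f (- x) <= 0] for all [x] ([unique_extensionP]).

    The 1 1/2-ball property allows one to replace any [y] in the infimum by a
    point [z] of [Y] that lies almost metrically between [x] and [y] and within
    [`|x| + 1] of [x] ([one_half_ball_between]).  Hence the infimum may be taken
    over a bounded set that does not depend on [f], and [p_f x] is Lipschitz in
    [f] for the dual norm ([upper_extension_near]).  The functionals with a
    unique extension therefore form a norm-closed set.  Property (wU) says that
    this set contains the norm-attaining functionals, which are dense in the
    dual of the complete space [Y] by the Bishop-Phelps theorem; so it is
    everything.

    Hahn-Banach is obtained from Zorn's lemma, a minimal sublinear functional
    being linear, and is used in the form of a sandwich theorem
    ([hahn_banach_sandwich]).  Bishop-Phelps follows from Ekeland's variational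
    principle and that sandwich theorem. *)

(** * Sublinear functionals and the Hahn-Banach theorem *)

Section sublinear_functionals.
Context {R : realType} {V : lmodType R}.
Implicit Types (p q : V -> R) (C : V -> R -> Prop).

Definition sublinear p :=
  (forall x y, p (x + y) <= p x + p y) /\
  (forall t x, 0 < t -> p (t *: x) = t * p x).

Lemma sublinear0 {p} : sublinear p -> p 0 = 0.
Proof. by move=> [_ pZ]; have := pZ 2%:R 0 (ltr0n _ 2); rewrite scaler0; lra. Qed.

Lemma sublinear_ge {p q} : sublinear q -> (forall x, q x <= p x) ->
  forall x, - p (- x) <= q x.
Proof.
move=> sq qp x; have := sq.1 x (- x); rewrite subrr (sublinear0 sq).
by have := qp (- x); lra.
Qed.

(** The inequality for [t^-1] is the reverse inequality for [t]. *)
Lemma sublinear_of_ler {q} : (forall x y, q (x + y) <= q x + q y) ->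
  (forall t x, 0 < t -> q (t *: x) <= t * q x) -> sublinear q.
Proof.
move=> qD qZ; split=> // t x t0; apply/le_anti; rewrite qZ//=.
have := qZ t^-1 (t *: x); rewrite invr_gt0 scalerA mulVf ?gt_eqF// scale1r.
by move=> /(_ t0); rewrite ler_pdivlMl.
Qed.

(** [C u a] is membership of [(u, a)] in a cone of [V * R]; it is read as the
    constraint [a <= h u] on a linear functional [h]. *)
Definition convex_cone C :=
  [/\ C 0 0,
      forall u v a b, C u a -> C v b -> C (u + v) (a + b)
    & forall t u a, 0 < t -> C u a -> C (t *: u) (t * a)].

(** For a convex cone, the largest sublinear functional below [p] such that every
    linear [h] below it satisfies the constraints in [C]: this is how constraints
    are absorbed into the dominating functional. *)
Definition lower_envelope p C (z : V) : R :=
  inf [set r | exists u a, C u a /\ r = p (z + u) - a].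

Section lower_envelope.
Context (p : V -> R) (C : V -> R -> Prop).
Hypothesis sp : sublinear p.
Hypothesis coneC : convex_cone C.
Hypothesis Cp : forall u a, C u a -> a <= p u.

Let lower_envelope_lb z :
  lbound [set r | exists u a, C u a /\ r = p (z + u) - a] (- p (- z)).
Proof.
move=> _ [u [a [Cua ->]]]; have := sp.1 (z + u) (- z).
by rewrite addrAC subrr add0r; have := Cp _ _ Cua; lra.
Qed.

Lemma lower_envelope_le z u a : C u a -> lower_envelope p C z <= p (z + u) - a.
Proof.
by move=> Cua; apply: ge_inf; [exists (- p (- z)) => ? /lower_envelope_lb|exists u, a].
Qed.

Lemma le_lower_envelope z m :
  (forall u a, C u a -> m <= p (z + u) - a) -> m <= lower_envelope p C z.
Proof.
move=> mle; apply: lb_le_inf; last by move=> _ [u [a [Cua ->]]]; exact: mle.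
by have [C0 _ _] := coneC; exists (p (z + 0) - 0), 0, 0.
Qed.

Lemma lower_envelope_le_self z : lower_envelope p C z <= p z.
Proof.
have [C0 _ _] := coneC.
by have := lower_envelope_le z _ _ C0; rewrite addr0 subr0.
Qed.

Lemma lower_envelope_opp u a : C u a -> lower_envelope p C (- u) <= - a.
Proof.
by move=> Cua; have := lower_envelope_le (- u) _ _ Cua; rewrite addNr sublinear0// add0r.
Qed.

Lemma sublinear_lower_envelope : sublinear (lower_envelope p C).
Proof.
have [_ CD CZ] := coneC; apply: sublinear_of_ler => [x y|t x t0].
- rewrite -lerBlDr; apply: le_lower_envelope => u a Cua.
  rewrite lerBlDl -lerBlDr; apply: le_lower_envelope => v b Cvb.
  have := lower_envelope_le (x + y) _ _ (CD _ _ _ _ Cua Cvb).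
  by have := sp.1 (x + u) (y + v); rewrite addrACA; lra.
- rewrite -ler_pdivrMl//; apply: le_lower_envelope => u a Cua.
  rewrite ler_pdivrMl// mulrBr -(sp.2 _ _ t0) scalerDr.
  exact/lower_envelope_le/CZ.
Qed.

End lower_envelope.

(** Chains have lower bounds because all [q <= p] satisfy [- p (- x) <= q x], so
    that the pointwise infimum of a chain is finite; it is sublinear since two
    members of a chain are dominated by the smaller one. *)
Lemma minimal_sublinear {p} : sublinear p ->
  exists q, [/\ sublinear q, forall x, q x <= p x &
    forall r, sublinear r -> (forall x, r x <= q x) -> r = q].
Proof.
move=> sp; pose T := {q : V -> R | sublinear q /\ forall x, q x <= p x}.
pose geT (q r : T) := `[< forall x, sval r x <= sval q x >].
have [| | |A totA|[q [sq qp]] qmin] := @Zorn T geT.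
- by move=> q; apply/asboolP.
- move=> q r s /asboolP qr /asboolP rs; apply/asboolP => x.
  exact: le_trans (rs x) (qr x).
- move=> [q Pq] [r Pr] /asboolP/= qr /asboolP/= rq; apply: eq_exist.
  by apply/funext => x; apply/le_anti; rewrite rq qr.
- have [[q0 Aq0]|A0] := pselect (A !=set0); last first.
    have Pp : sublinear p /\ forall x, p x <= p x by [].
    by exists (exist _ p Pp) => q Aq; case: A0; exists q.
  pose m x := inf [set sval q x | q in A].
  have m_le (q : T) x : A q -> m x <= sval q x.
    move=> Aq; apply: ge_inf; last by exists q.
    by exists (- p (- x)) => _ [r _ <-]; apply: sublinear_ge;
      [exact: (svalP r).1|exact: (svalP r).2].
  have le_m x c : (forall q : T, A q -> c <= sval q x) -> c <= m x.
    move=> cle; apply: lb_le_inf; first by exists (sval q0 x), q0.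
    by move=> _ [r Ar <-]; exact: cle.
  have sm : sublinear m /\ forall x, m x <= p x.
    split=> [|x]; last exact: le_trans (m_le _ _ Aq0) ((svalP q0).2 x).
    apply: sublinear_of_ler => [x y|t x t0].
    + rewrite -lerBlDr; apply: (le_m) => q Aq.
      rewrite lerBlDl -lerBlDr; apply: (le_m) => r Ar.
      rewrite lerBlDr.
      have [/asboolP qr|/asboolP rq] := totA _ _ Aq Ar.
      * have := (svalP r).1.1 x y; have := qr x; have := m_le _ (x + y) Ar; lra.
      * have := (svalP q).1.1 x y; have := rq y; have := m_le _ (x + y) Aq; lra.
    + rewrite -ler_pdivrMl//; apply: (le_m) => q Aq.
      by rewrite ler_pdivrMl// -((svalP q).1.2 _ _ t0) m_le.
  by exists (exist _ m sm) => q Aq; apply/asboolP => x; exact: m_le.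
exists q; split=> // r sr rq.
have Pr : sublinear r /\ forall x, r x <= p x.
  by split=> // x; exact: le_trans (rq x) (qp x).
by have /(_ _)/(congr1 sval) := qmin (exist _ r Pr); apply; apply/asboolP.
Qed.

Definition half_line (y : V) (b : R) u a :=
  exists2 t, 0 <= t & u = t *: y /\ a = t * b.

Lemma half_line_mem y b : half_line y b y b.
Proof. by exists 1 => //; rewrite scale1r mul1r. Qed.

Lemma half_line_cone {q} y : sublinear q ->
  convex_cone (half_line y (q y)) /\
  forall u a, half_line y (q y) u a -> a <= q u.
Proof.
move=> sq; split=> [|_ _ [t + [-> ->]]]; last first.
  rewrite le_eqVlt => /predU1P[<-|t0]; last by rewrite sq.2.
  by rewrite mul0r scale0r (sublinear0 sq).
split=> [|_ _ _ _ [s s0 [-> ->]] [t t0 [-> ->]]|t _ _ t0 [s s0 [-> ->]]].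
- by exists 0 => //; rewrite scale0r mul0r.
- by exists (s + t); rewrite ?addr_ge0// scalerDl mulrDl.
- by exists (t * s); [exact: mulr_ge0 (ltW t0) s0|rewrite scalerA mulrA].
Qed.

(** A minimal sublinear [q] is linear: its lower envelope for the constraint
    [q y <= h y] is sublinear and below [q], hence equal to [q], and so
    [q (- y) <= - q y]. *)
Lemma hahn_banach {p} : sublinear p ->
  exists h : {linear V -> R^o}, forall x, h x <= p x.
Proof.
move=> /minimal_sublinear[q [sq qp qmin]].
have qN y : q (- y) = - q y.
  apply/le_anti; have := sublinear_ge sq (fun=> lexx _) (- y).
  rewrite opprK => ->; rewrite andbT.
  pose C := half_line y (q y); have [coneC Cq] := half_line_cone y sq.
  have Cy : C y (q y) by exact: half_line_mem.
  have := lower_envelope_opp q C sq Cq _ _ Cy.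
  by rewrite (qmin _ (sublinear_lower_envelope q C sq coneC Cq)
    (lower_envelope_le_self q C sq coneC Cq)).
have qD x y : q (x + y) = q x + q y.
  apply/le_anti; rewrite sq.1/=.
  by have := sq.1 (x + y) (- y); rewrite addrK qN; lra.
have qZ t x : q (t *: x) = t * q x.
  have [t0|t0|->] := ltgtP t 0; last by rewrite scale0r mul0r (sublinear0 sq).
  - by rewrite -[t]opprK scaleNr qN sq.2 ?mulNr// oppr_gt0.
  - exact: sq.2.
have qlin : linear (q : V -> R^o) by move=> a x y; rewrite qD qZ.
pose lq := GRing.isLinear.Build R V R^o *:%R (q : V -> R^o) qlin.
pose h : {linear V -> R^o} := HB.pack (q : V -> R^o) lq.
by exists h.
Qed.

Lemma hahn_banach_sandwich {p} {C} : sublinear p -> convex_cone C ->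
    (forall u a, C u a -> a <= p u) ->
  exists2 h : {linear V -> R^o}, (forall x, h x <= p x) &
    forall u a, C u a -> a <= h u.
Proof.
move=> sp coneC Cp.
have [h hp] := hahn_banach (sublinear_lower_envelope p C sp coneC Cp).
exists h => [x|u a Cua].
  exact: le_trans (hp x) (lower_envelope_le_self p C sp coneC Cp x).
have := hp (- u); rewrite linearN; have := lower_envelope_opp p C sp Cp _ _ Cua.
by move=> /[swap] /le_trans/[apply]; rewrite lerN2.
Qed.

(** The constraint [p x0 <= h x0] is compatible with [h <= p]. *)
Lemma hahn_banach_at {p} (x0 : V) : sublinear p ->
  exists2 h : {linear V -> R^o}, (forall x, h x <= p x) & h x0 = p x0.
Proof.
move=> sp; have [coneC Cp] := half_line_cone x0 sp.
have [h hp Ch] := hahn_banach_sandwich sp coneC Cp; exists h => //.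
by apply/le_anti; rewrite hp Ch//; exact: half_line_mem.
Qed.

End sublinear_functionals.
(** * Norm-preserving extensions *)

(** Needed because uniqueness of extensions refers to equality of bundled linear
    maps; the bundled proofs are irrelevant. *)
Lemma linear_ext {R : pzRingType} {U : lmodType R} {V : lmodType R}
  (f g : {linear U -> V}) : f =1 g -> f = g.
Proof.
case: f => f [[m1] [m2]]; case: g => g [[n1] [n2]] /= /funext fg.
case: _ / fg n1 n2 => n1 n2.
by rewrite (Prop_irrelevance m1 n1) (Prop_irrelevance m2 n2).
Qed.

Section dual_norm.
Context {R : realType} {V : normedModType R}.
Implicit Types f : {linear V -> R^o}.

Lemma sublinear_norm {N : R} : 0 <= N -> sublinear (fun x : V => N * `|x|).
Proof.
move=> N0; split=> [x y|t x t0]; first by rewrite -mulrDr ler_wpM2l ?ler_normD.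
by rewrite normrZ gtr0_norm// mulrCA.
Qed.

Lemma ler_dual_norm {f} : bounded_fun_norm f ->
  forall x, `|f x| <= dual_norm f * `|x|.
Proof.
move=> /(_ 1)[M fM] x; have [->|x0] := eqVneq x 0.
  by rewrite linear0 !normr0 mulr0.
rewrite -ler_pdivrMr ?normr_gt0// -[X in _ / X]normr_id -normf_div.
have -> : f x / `|x| = f (`|x|^-1 *: x) by rewrite linearZ/= mulrC.
apply: ub_le_sup; first by exists M => _ [z z1 <-]; exact: fM.
exists (`|x|^-1 *: x) => //=.
by rewrite normrZ normfV normr_id mulVf// normr_eq0.
Qed.

Lemma dual_norm_ge0 {f} : bounded_fun_norm f -> 0 <= dual_norm f.
Proof.
move=> /(_ 1)[M fM]; apply: ub_le_sup.
  by exists M => _ [z z1 <-]; exact: fM.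
by exists 0; rewrite /= ?normr0 ?linear0 ?normr0.
Qed.

(** For linear functionals one-sided bounds suffice, by symmetry of the norm. *)
Lemma norm_le_of_le {f} {M : R} : (forall x, f x <= M * `|x|) ->
  forall x, `|f x| <= M * `|x|.
Proof.
move=> fM x; rewrite ler_norml fM andbT.
by have := fM (- x); rewrite linearN normrN lerNl.
Qed.

Lemma bounded_of_le {f} {M : R} : (forall x, f x <= M * `|x|) ->
  bounded_fun_norm f.
Proof.
move=> /norm_le_of_le fM r; exists (`|M| * r) => x xr.
apply: (le_trans (fM x)); apply: (@le_trans _ _ (`|M| * `|x|)).
  by rewrite ler_wpM2r// ler_norm.
by rewrite ler_wpM2l.
Qed.

Lemma dual_norm_le {f} {M : R} : 0 <= M -> (forall x, f x <= M * `|x|) ->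
  dual_norm f <= M.
Proof.
move=> M0 /norm_le_of_le fM; apply: ge_sup.
  by exists `|f 0|, 0; rewrite //= normr0.
move=> _ [x /= x1 <-]; apply: (le_trans (fM x)).
by rewrite -[leRHS]mulr1 ler_wpM2l.
Qed.

End dual_norm.

Section extensions.
Context {R : realType} {X : normedModType R} {Y : submodClosed X}.
Implicit Types (f : {linear subspace_of Y -> R^o}) (g h : {linear X -> R^o}).

(** As a family of constraints, the graph forces [f <= h] on [Y], and therefore
    [h = f] there since [Y] is symmetric. *)
Definition graph f (u : X) (a : R) :=
  exists y : subspace_of Y, u = val y /\ a = f y.

Lemma graph_cone f : convex_cone (graph f).
Proof.
split=> [|_ _ _ _ [y [-> ->]] [z [-> ->]]|t _ _ t0 [y [-> ->]]].
- by exists 0; rewrite !linear0.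
- by exists (y + z); rewrite !linearD.
- by exists (t *: y); rewrite !linearZ.
Qed.

Lemma graph_le_norm {f} : bounded_fun_norm f ->
  forall u a, graph f u a -> a <= dual_norm f * `|u|.
Proof.
move=> bf _ _ [y [-> ->]].
by apply: le_trans (ler_dual_norm bf y); exact: ler_norm.
Qed.

(** The infimum over [y] in [Y] of [dual_norm f * `|x - y| + f y]; for
    bounded [f], the largest value at [x] of a norm-preserving extension. *)
Definition upper_extension f : X -> R :=
  lower_envelope (fun x => dual_norm f * `|x|) (graph f).

Section upper_extension.
Context {f} (bf : bounded_fun_norm f).
Let sN := sublinear_norm (V := X) (dual_norm_ge0 bf).
Let Cp := graph_le_norm bf.

Lemma sublinear_upper_extension : sublinear (upper_extension f).
Proof. exact: sublinear_lower_envelope sN (graph_cone f) Cp. Qed.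

Lemma upper_extension_le x (y : subspace_of Y) :
  upper_extension f x <= dual_norm f * `|x - val y| + f y.
Proof.
have Cy : graph f (- val y) (- f y) by exists (- y); rewrite !linearN.
by have := lower_envelope_le _ _ sN Cp x _ _ Cy; rewrite opprK.
Qed.

Lemma le_upper_extension x m :
  (forall y : subspace_of Y, m <= dual_norm f * `|x - val y| + f y) ->
  m <= upper_extension f x.
Proof.
move=> mle; apply: le_lower_envelope (graph_cone f) _ _ _ => _ _ [y [-> ->]].
by have := mle (- y); rewrite !linearN opprK.
Qed.

(** [g x - f y = g (x - y)] is at most the norm of [g] times [`|x - y|]. *)
Lemma extension_le_upper {g} : norm_preserving_extension f g ->
  forall x, g x <= upper_extension f x.
Proof.
move=> [bg gf nf] x; apply: le_upper_extension => y.
rewrite -lerBlDr -gf -linearB -nf.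
exact: le_trans (ler_norm _) (ler_dual_norm bg _).
Qed.

(** Taking [y = 0] in the infimum bounds the norm of [g]; taking [y = x] for [x]
    in [Y] makes [g] agree with [f] there. *)
Lemma extension_of_le_upper {g} : (forall x, g x <= upper_extension f x) ->
  norm_preserving_extension f g.
Proof.
move=> gle.
have gN x : g x <= dual_norm f * `|x|.
  apply: le_trans (gle x) _; have := upper_extension_le x 0.
  by rewrite subr0 raddf0 addr0.
have bg := bounded_of_le gN.
have fg y : f y <= g (val y).
  rewrite -lerN2 -linearN; apply: (le_trans (gle _)).
  by have := upper_extension_le (- val y) (- y); rewrite !linearN subrr normr0 mulr0 add0r.
have gf y : g (val y) = f y.
  apply/le_anti; rewrite fg andbT.
  by have := fg (- y); rewrite !linearN lerN2.
split=> //; apply/le_anti; rewrite dual_norm_le ?dual_norm_ge0//=.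
apply: dual_norm_le => [|y]; first exact: dual_norm_ge0.
rewrite -gf; exact: le_trans (ler_norm _) (ler_dual_norm bg _).
Qed.

(** Extensions range at [x] exactly over the interval from
    [- upper_extension f (- x)] to [upper_extension f x], both ends being
    attained. *)
Lemma unique_extensionP :
  (exists! g, norm_preserving_extension f g) <->
  forall x, upper_extension f x + upper_extension f (- x) <= 0.
Proof.
split=> [[g [_ gu]] x|upper0].
  have [h1 h1le <-] := hahn_banach_at x sublinear_upper_extension.
  have [h2 h2le <-] := hahn_banach_at (- x) sublinear_upper_extension.
  rewrite -(gu _ (extension_of_le_upper h1le)) -(gu _ (extension_of_le_upper h2le)).
  by rewrite linearN subrr.
have [g gle] := hahn_banach sublinear_upper_extension.
exists g; split=> [|h /extension_le_upper hle]; first exact: extension_of_le_upper.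
have lin_eq (k : {linear X -> R^o}) : (forall x, k x <= upper_extension f x) ->
    forall x, k x = upper_extension f x.
  move=> kle x; apply/le_anti; rewrite kle/=.
  by have := kle (- x); have := upper0 x; rewrite linearN; lra.
by apply: linear_ext => x; rewrite (lin_eq _ gle) (lin_eq _ hle).
Qed.

End upper_extension.
End extensions.

(** * Stability of the upper extension under the 1 1/2-ball property *)

Section one_half_ball.
Context {R : realType} {X : normedModType R} {Y : submodClosed X}.
Implicit Types f g : {linear subspace_of Y -> R^o}.
Hypothesis ballY : one_half_ball_property Y.

(** The two balls are centred at [x], with radius [`|x| + 1] so that it contains
    [0], and at [y], with a radius that just makes the sum of the radii exceed
    [`|x - y|]. *)
Lemma one_half_ball_between (x : X) (y : subspace_of Y) (d : R) : 0 < d ->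
  exists z : subspace_of Y, `|x - val z| <= `|x| + 1 /\
    `|x - val z| + `|val z - val y| <= `|x - val y| + d.
Proof.
move=> d0; have [xy|xy] := leP `|x - val y| (`|x| + 1).
  by exists y; split=> //; rewrite subrr normr0 addr0 lerDl ltW.
have r2 : 0 < `|x| + 1 by rewrite ltr_pwDr.
have r1 : 0 < `|x - val y| + d - (`|x| + 1) by lra.
have [] := ballY x (val y) _ _ (valP y) r1 r2.
- by rewrite subrK ltrDl.
- by exists 0; split; rewrite /closed_ball_/= ?subr0 ?lerDl// rpred0.
move=> z [[/= yz xz] zY]; exists (SubspaceOf zY) => /=; split=> //.
by move: yz xz; rewrite /closed_ball_/= distrC; lra.
Qed.

(** Bounding the distance from [z] to [x] is what makes the error term independent
    of the point [y] at which the infimum is approached: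
    [`|z| + `|x - z|] is at most [3 * `|x| + 2]. *)
Lemma upper_extension_near f g (e : R) (x : X) :
  bounded_fun_norm f -> bounded_fun_norm g -> 0 <= e ->
  (forall y, f y <= g y + e * `|y|) ->
  upper_extension f x <= upper_extension g x + e * (3 * `|x| + 2).
Proof.
move=> bf bg e0 fg; rewrite -lerBlDr; apply: le_upper_extension => y.
apply/ler_addgt0Pr => d d0.
have Ng0 := dual_norm_ge0 bg; have N1 : 0 < dual_norm g + 1 by rewrite ltr_pwDr.
have [z [xz zy]] := one_half_ball_between x y _ (divr_gt0 d0 N1).
have Nfg : dual_norm f <= dual_norm g + e.
  apply: dual_norm_le => [|u]; first exact: addr_ge0.
  apply: (le_trans (fg u)); rewrite mulrDl lerD2r.
  exact: le_trans (ler_norm _) (ler_dual_norm bg _).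
have gzy : g z <= g y + dual_norm g * `|val z - val y|.
  rewrite -lerBlDl -linearB.
  exact: le_trans (ler_norm _) (ler_dual_norm bg (z - y)).
have znorm : `|z| <= 2 * `|x| + 1.
  have := ler_normB x (x - val z); rewrite opprB addrC subrK => zx.
  by apply: (le_trans zx); lra.
have := upper_extension_le bf x z; have := fg z.
have : dual_norm f * `|x - val z| <= dual_norm g * `|x - val z| + e * `|x - val z|.
  by rewrite -mulrDl ler_wpM2r.
have : e * (`|z| + `|x - val z|) <= e * (3 * `|x| + 2) by rewrite ler_wpM2l//; lra.
have := ler_wpM2l Ng0 zy; rewrite !mulrDr.
have : dual_norm g * (d / (dual_norm g + 1)) <= d.
  by rewrite mulrCA ger_pMr// ler_pdivrMr// mul1r lerDl.
lra.
Qed.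

End one_half_ball.

(** * Ekeland's variational principle and the Bishop-Phelps theorem *)

Section variational_principle.
Context {R : realType} {X : completeNormedModType R}.

(** For [y] in [C] let [S y] be the points of [C] at which [F] exceeds [F y] by at
    least [e] times their distance to [y].  Moving repeatedly to an almost maximal
    point of [S] gives a Cauchy sequence, whose limit [z] lies in all the sets
    [S (u n)]; a point [w] violating the conclusion would lie in all of them too,
    hence satisfy [F w <= F z]. *)
Lemma ekeland (F : X -> R) (C : set X) (e : R) :
  continuous F -> closed C -> C !=set0 -> has_ubound (F @` C) -> 0 < e ->
  exists2 z, C z & forall w, C w -> F w <= F z + e * `|w - z|.
Proof.
move=> cF clC [x0 Cx0] ubF e0.
pose S y := [set z | C z /\ e * `|z - y| <= F z - F y].
have SC y z : S y z -> C z by case.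
have S_refl y : C y -> S y y by move=> Cy; split=> //; rewrite !subrr normr0 mulr0.
have S_trans y z w : S y z -> S z w -> S y w.
  move=> [Cz yz] [Cw zw]; split=> //; apply: le_trans (_ : e * (`|w - z| + `|z - y|) <= _).
    by rewrite ler_wpM2l ?(ltW e0)// ler_distD.
  by rewrite mulrDr; lra.
have step (p : nat * X) : exists z, C p.2 ->
    S p.2 z /\ forall w, S p.2 w -> F w <= F z + e * p.1.+1%:R^-1.
  have [Cp|Cp] := pselect (C p.2); last by exists 0.
  have supS : has_sup (F @` S p.2).
    split; first by exists (F p.2), p.2 => //; exact: S_refl.
    case: ubF => M FM; exists M => _ [w /SC Cw <-]; apply: FM.
    by exists w.
  have n0 : 0 < e * p.1.+1%:R^-1 :> R by rewrite mulr_gt0// invr_gt0 ltr0n.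
  have [_ [z Sz <-] zsup] := sup_adherent n0 supS.
  exists z => _; split=> // w Sw; rewrite -lerBlDr; apply: ltW; apply: le_lt_trans zsup.
  by rewrite lerD2r; apply: ub_le_sup supS.2 _ _; exists w.
have [next nextP] := choice step.
pose u := fix u n := if n is k.+1 then next (k, u k) else x0.
have uC n : C (u n).
  by elim: n => //= n Cn; have [/SC] := nextP (n, u n) Cn.
have uS n : S (u n) (u n.+1) by have [] := nextP (n, u n) (uC n).
have u_max n w : S (u n) w -> F w <= F (u n.+1) + e * n.+1%:R^-1.
  by have [_] := nextP (n, u n) (uC n); exact.
have uSS n k : S (u n) (u (n + k)%N).
  elim: k => [|k IHk]; first by rewrite addn0; exact: S_refl.
  by rewrite addnS; exact: S_trans IHk (uS _).
have u_close n k : `|u (n.+1 + k)%N - u n.+1| <= n.+1%:R^-1.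
  have [_ close] := uSS n.+1 k; rewrite -(ler_pM2l e0); apply: (le_trans close).
  by rewrite lerBlDl; apply: u_max; exact: S_trans (uS n) (uSS _ _).
have /cvg_ex[z uz] : cvg (u @ \oo).
  apply: cauchy_cvg; apply: cauchy_exP => d d0.
  (* The gain of [F] beyond [u n.+1] is at most [e / n.+1], so the tail has
     radius [1 / n.+1]. *)
  have [n nd] : exists n, n.+1%:R^-1 < d.
    by have [N _ Nd] := near_infty_natSinv_lt (PosNum d0); exists N; exact: (Nd N (leqnn N)).
  exists (u n.+1); exists n.+1 => // m /= nm; rewrite -ball_normE/= distrC.
  by rewrite -(subnKC nm); exact: le_lt_trans (u_close _ _) nd.
have Cz : C z by apply: closed_cvg clC _ _ uz; near=> n; exact: uC.
have Fz : F (u n) @[n --> \oo] --> F z by apply: continuous_cvg uz; exact: cF.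
have uSz n : S (u n) z.
  split=> //.
  have lhs : e * `|u m - u n| @[m --> \oo] --> e * `|z - u n|.
    by apply: cvgMr; apply: cvg_norm; apply: cvgB uz _; exact: cvg_cst.
  have rhs : F (u m) - F (u n) @[m --> \oo] --> F z - F (u n).
    by apply: cvgB Fz _; exact: cvg_cst.
  apply: ler_cvg_to lhs rhs _; near=> m.
  have nm : (n <= m)%N by near: m; exact: nbhs_infty_ge.
  by rewrite -(subnKC nm); have [] := uSS n (m - n)%N.
exists z => // w Cw; rewrite leNgt; apply/negP => zw.
have Szw : S z w by split=> //; rewrite lerBrDl ltW.
have : F w <= F z.
  apply/ler_addgt0Pr => d d0.
  have [n nd] : exists n, n.+1%:R^-1 < d / e.
    have [N _ Nd] := near_infty_natSinv_lt (PosNum (divr_gt0 d0 e0)).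
    by exists N; exact: (Nd N (leqnn N)).
  have := u_max n w (S_trans _ _ _ (uSz n) Szw).
  have [_ uz_le] := uSz n.+1.
  move=> /le_trans; apply; apply: lerD.
    by rewrite -subr_ge0; apply: le_trans uz_le; rewrite mulr_ge0 ?(ltW e0).
  by rewrite -ler_pdivlMl// mulrC ltW.
apply/negP; rewrite -ltNge; apply: le_lt_trans zw.
by rewrite lerDl mulr_ge0 ?(ltW e0).
Unshelve. all: by end_near. Qed.

End variational_principle.

Section bishop_phelps.

(** The concave function [y |-> f y - f y0] on the unit ball lies below the convex
    function [y |-> e * `|y - y0|]; a linear [h] that separates them, transported
    to the origin, is the perturbation, and [g = f - h]. *)
Lemma supporting_perturbation {R : realType} {V : normedModType R}
    (f : {linear V -> R^o}) (e : R) (y0 : V) : 0 <= e -> `|y0| <= 1 ->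
    (forall y, `|y| <= 1 -> f y <= f y0 + e * `|y - y0|) ->
  exists g : {linear V -> R^o}, (forall y, `|f y - g y| <= e * `|y|) /\
    (forall y, `|y| <= 1 -> g y <= g y0).
Proof.
move=> e0 y01 fle.
pose C u a := exists t y, [/\ 0 <= t, `|y| <= 1, u = t *: (y - y0) & a = t * (f y - f y0)].
have coneC : convex_cone C.
  split=> [|_ _ _ _ [s [y [s0 y1 -> ->]]] [t [z [t0 z1 -> ->]]]|t _ _ t0 [s [y [s0 y1 -> ->]]]].
  - by exists 0, y0; rewrite scale0r mul0r.
  (* A sum of multiples of [y - y0] and [z - y0] is a multiple of [w - y0] for
       the convex combination [w] of [y] and [z] with weights [s] and [t]. *)
  - have [st0|st0] := eqVneq (s + t) 0.
      have [-> ->] : s = 0 /\ t = 0 by lra.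
      by exists 0, y0; rewrite !scale0r !mul0r !addr0.
    exists (s + t), ((s + t)^-1 *: (s *: y + t *: z)); split.
    + exact: addr_ge0.
    + rewrite normrZ ger0_norm ?invr_ge0 ?addr_ge0//.
      rewrite ler_pdivrMl ?mulr1; last by rewrite lt_neqAle eq_sym st0 addr_ge0.
      apply: (le_trans (ler_normD _ _)); rewrite !normrZ !ger0_norm//.
      by apply: lerD; rewrite -[leRHS]mulr1 ler_wpM2l.
    + by rewrite [RHS]scalerBr scalerA mulfV// scale1r !scalerBr scalerDl opprD addrACA.
    + rewrite linearZ/= linearD !linearZ/= [RHS]mulrBr mulrA mulfV// mul1r.
      by rewrite !mulrBr mulrDl opprD addrACA.
  - by exists (t * s), y; rewrite scalerA mulrA mulr_ge0 ?(ltW t0).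
have Cle u a : C u a -> a <= e * `|u|.
  move=> [t [y [t0 y1 -> ->]]]; rewrite normrZ ger0_norm// mulrCA ler_wpM2l//.
  by rewrite lerBlDl fle.
have [h hle Ch] := hahn_banach_sandwich (sublinear_norm e0) coneC Cle.
exists (f \- h); split=> [y|y y1] /=.
  by rewrite opprB addrC subrK; exact: norm_le_of_le.
have : f y - f y0 <= h (y - y0).
  by apply: Ch; exists 1, y; rewrite scale1r mul1r ler01.
rewrite linearB; lra.
Qed.

(** By homogeneity [g y <= g y0 * `|y|] for all [y], and [y = y0] excludes
    [`|y0| < 1]. *)
Lemma norm_attained {R : realType} {V : normedModType R}
    (g : {linear V -> R^o}) (y0 : V) :
    bounded_fun_norm g -> dual_norm g != 0 -> `|y0| <= 1 ->
    (forall y, `|y| <= 1 -> g y <= g y0) ->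
  `|y0| = 1 /\ dual_norm g = `|g y0|.
Proof.
move=> bg ng y01 gy0.
have g0 : 0 <= g y0 by have := gy0 0; rewrite normr0 linear0; apply.
have gle y : g y <= g y0 * `|y|.
  have [->|yN0] := eqVneq y 0; first by rewrite linear0 normr0 mulr0.
  have /gy0 : `| `|y|^-1 *: y| <= 1.
    by rewrite normrZ normfV normr_id mulVf// normr_eq0.
  by rewrite linearZ/= ler_pdivrMl ?normr_gt0// mulrC.
have le_g : dual_norm g <= g y0 by exact: dual_norm_le.
have gy0_gt : 0 < g y0.
  by apply: lt_le_trans le_g; rewrite lt_neqAle eq_sym ng dual_norm_ge0.
split.
  apply/le_anti; rewrite y01/=.
  by have := gle y0; rewrite ler_pMr.
rewrite ger0_norm//; apply/le_anti; rewrite le_g/=.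
apply: le_trans (ler_norm _) _; apply: (le_trans (ler_dual_norm bg y0)).
by rewrite -[leRHS]mulr1 ler_wpM2l// dual_norm_ge0.
Qed.

Lemma bounded_linear_functional_continuous {R : realType} {V : normedModType R}
  (f : {linear V -> R^o}) : bounded_fun_norm f -> continuous (f : V -> R).
Proof.
by move=> /bounded_funP; exact: bounded_linear_continuous. Qed.

(** Ekeland's principle is applied in [X] to an extension of [f] on the closed set
    of points of [Y] of norm at most [1].  The condition [e < dual_norm f] keeps
    the approximating functional away from [0], so that its maximum over the ball
    lies on the unit sphere. *)
Lemma bishop_phelps {R : realType} {X : completeNormedModType R}
    {Y : submodClosed X} (f : {linear subspace_of Y -> R^o}) (e : R) :
    closed [set` Y] -> bounded_fun_norm f -> 0 < e -> e < dual_norm f ->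
  exists g : {linear subspace_of Y -> R^o},
    [/\ bounded_fun_norm g, forall y, `|f y - g y| <= e * `|y| &
        exists2 y0, `|y0| = 1 & dual_norm g = `|g y0|].
Proof.
move=> clY bf e0 ef.
have [F /(extension_of_le_upper bf)[bF Ff _]] :=
  hahn_banach (sublinear_upper_extension bf).
pose B : set X := [set` Y] `&` [set x | `|x| <= 1].
have clB : closed B.
  apply: closedI clY _.
  by apply: (@closed_comp _ _ (fun x : X => `|x|) [set r : R | r <= 1]);
    [move=> x _; exact: norm_continuous|exact: closed_le].
have B0 : B !=set0 by exists 0; split; rewrite /= ?rpred0 ?normr0.
have ubF : has_ubound ((F : X -> R) @` B).
  have [M FM] := bF 1; exists M => _ [x [_ x1] <-].
  exact: le_trans (ler_norm _) (FM _ x1).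
have [y0 [y0Y y01] y0max] :=
  ekeland F B e (bounded_linear_functional_continuous _ bF) clB B0 ubF e0.
pose u0 : subspace_of Y := SubspaceOf y0Y; have u01 : `|u0| <= 1 by [].
have fmax (y : subspace_of Y) : `|y| <= 1 -> f y <= f u0 + e * `|y - u0|.
  by move=> y1; rewrite -!Ff; apply: y0max; split=> //; exact: valP.
have [g [fg gmax]] := supporting_perturbation f e u0 (ltW e0) u01 fmax.
have gle y : g y <= (dual_norm f + e) * `|y|.
  rewrite mulrDl; have := fg y; have := ler_dual_norm bf y.
  by rewrite !ler_norml; lra.
have bg := bounded_of_le gle.
have ng : dual_norm g != 0.
  apply/eqP => ng; suff : dual_norm f <= e by rewrite leNgt ef.
  apply: dual_norm_le (ltW e0) _ => y; have := fg y; have := ler_dual_norm bg y.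
  by rewrite ng mul0r !ler_norml; lra.
have [u0_norm g_at_u0] := norm_attained g u0 bg ng u01 gmax.
by exists g; split=> //; exists u0.
Qed.

End bishop_phelps.

Theorem theorem2p4 (R : realType) (X : completeNormedModType R)
    (Y : submodClosed X) (hYclosed : closed [set` Y])
    (hYball : one_half_ball_property Y) :
  property_wU Y <-> property_U Y.
Proof.
split=> [wU f bf|U f bf _]; last exact: U.
apply/(unique_extensionP bf) => x.
(* Bishop-Phelps needs room below the norm of [f]. *)
have [f0|fN0] := eqVneq (dual_norm f) 0.
  have le0 z : upper_extension f z <= 0.
    by have := upper_extension_le bf z 0; rewrite f0 mul0r raddf0 addr0.
  by rewrite -[leRHS]addr0 lerD.
have f_gt0 : 0 < dual_norm f by rewrite lt_neqAle eq_sym fN0 dual_norm_ge0.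
apply/ler_addgt0Pr => d d0; rewrite add0r.
(* Twice the error factor, for the points [x] and [- x]. *)
pose c : R := 2 * (3 * `|x| + 2).
have c0 : 0 < c by rewrite mulr_gt0// ltr_wpDl// mulr_ge0.
pose e := Num.min (dual_norm f / 2) (d / c).
have e0 : 0 < e by rewrite lt_min !divr_gt0.
have ef : e < dual_norm f by rewrite gt_min ltr_pdivrMr// ltr_pMr// ltr1n.
have ed : e * c <= d by rewrite -ler_pdivlMr// ge_min lexx orbT.
have [g [bg fg gattains]] := bishop_phelps f e hYclosed bf e0 ef.
have /(unique_extensionP bg)/(_ x) := wU g bg gattains.
have fge y : f y <= g y + e * `|y| by have := fg y; rewrite ler_norml; lra.
have := upper_extension_near hYball f g e x bf bg (ltW e0) fge.
have := upper_extension_near hYball f g e (- x) bf bg (ltW e0) fge.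
by move: ed; rewrite /c normrN; lra.
Qed.
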